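(* Let $X$, $Y$, $Z$ be positive, absolutely continuous random variables with densities $f_X$, $f_Y$, $f_Z$, such that $X$ and $Y$ are independent and $Z \stackrel{d}{=} X/(X+Y)$ (so $Z$ takes values in $(0,1)$). Suppose that the density of $Y$ admits the decomposition $$f_Y(sx)=\mathbb{A}(s)\,\mathbb{B}(x)\,\mathbb{C}(sx),\qquad x,s>0,$$ for some positive real-valued functions $\mathbb{A},\mathbb{B},\mathbb{C}$ on $(0,\infty)$, where $$\mathbb{C}(x)=(p+qx)\exp(-\lambda x),\qquad x>0,$$ for some constants $q,\lambda>0$ and $p\geq 0$. Then, whenever $\big[x^{(\lambda p/q)+2}\,\mathbb{B}(x)\,f_X(x)\big]\big|_{x=0^+}=0$ (i.e. this expression tends to $0$ as $x\to 0^+$), the density of $X$ is given, for $x>0$, by $$f_X(x)=\frac{\lambda^3}{q\,x^{(\lambda p/q)+2}\,\mathbb{B}(x)}\int_0^x \xi^{\lambda p/q}\,\mathcal{L}^{-1}\left\{\frac{1}{\mathbb{A}\!\left(\frac{s}{\lambda}\right)(s+\lambda)^2}\, f_Z\!\left(\frac{\lambda}{s+\lambda}\right)\right\}(\xi)\,\mathrm{d}\xi.$$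
   Context: $\mathcal{L}$ denotes the Laplace transform, $\mathcal{L}\{g\}(s)=\int_0^\infty e^{-st}g(t)\,\mathrm{d}t$, and $\mathcal{L}^{-1}$ denotes the inverse Laplace transform: $\mathcal{L}^{-1}\{F\}$ is the function $g$ on $(0,\infty)$ with $\mathcal{L}\{g\}=F$; $\mathcal{L}^{-1}\{F\}(\xi)$ means this function evaluated at $\xi$. The notation $\stackrel{d}{=}$ means equality in distribution. *)

(* Defs.v *)
From HB Require Import structures.
From mathcomp Require Import all_boot all_order all_algebra.
From mathcomp Require Import all_classical all_reals all_analysis.
Set Implicit Arguments. Unset Strict Implicit. Unset Printing Implicit Defensive.
Import Order.TTheory GRing.Theory Num.Theory.
Import numFieldNormedType.Exports.
Local Open Scope classical_set_scope.
Local Open Scope ring_scope.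

Definition indep2 d (T : measurableType d) (R : realType) (P : probability T R)
  (X Y : T -> R) : Prop :=
  forall A B : set R, measurable A -> measurable B ->
    P (X @^-1` A `&` Y @^-1` B) = (P (X @^-1` A) * P (Y @^-1` B))%E.

Definition is_density d (T : measurableType d) (R : realType) (P : probability T R)
  (X : T -> R) (f : R -> R) : Prop :=
  (forall x, 0 <= f x) /\ measurable_fun setT f /\
  forall A : set R, measurable A ->
    P (X @^-1` A) = (\int[lebesgue_measure]_(x in A) (f x)%:E)%E.

Definition laplace (R : realType) (g : R -> R) (s : R) : R :=
  Rintegral lebesgue_measure `]0, +oo[%classic (fun t => expR (- (s * t)) * g t).

Definition is_inv_laplace (R : realType) (F : R -> R) (g : R -> R) : Prop :=
  forall s : R, 0 < s ->
    lebesgue_measure.-integrable `]0, +oo[%classic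
       (fun t => (expR (- (s * t)) * g t)%:E) /\
    laplace g s = F s.

(* Main.v *)
Require Import Defs.
From HB Require Import structures.
From mathcomp Require Import all_boot all_order all_algebra.
From mathcomp Require Import all_classical all_reals all_analysis.
From mathcomp Require Import measurable_realfun ring lra.
Set Implicit Arguments. Unset Strict Implicit. Unset Printing Implicit Defensive.
Import Order.TTheory GRing.Theory Num.Theory.
Import numFieldNormedType.Exports.
Local Open Scope classical_set_scope.
Local Open Scope ring_scope.

(** Put [a = lam p / q] and [G x = (q / lam^3) x^2 B(x) fX(x)]. Conditioning on
    [X] and inserting the factorization of [fY], the density of [X / (X + Y)] at
    [lam / (lam + s)] shows that the Laplace transform of [h] at [s] equals that
    of [(a / x + s) G], for almost every [s > 0]. Formally this is the equation
    [G' + (a / x) G = h], but [G] is only measurable. So let [K t] be the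
    integral of [h - (a / x) G] over [(0, t)]: by Fubini, [s] times the transform
    of [K] is the transform of [h - (a / x) G], that is, [s] times the transform
    of [G], and uniqueness of the Laplace transform gives [K = G] almost
    everywhere. Fubini with the kernel [a t^(a - 1)] then yields that [x^a K x]
    is the integral of [xi^a h(xi)] over [(0, x)]. No boundary term appears,
    because [h] and [(a / x) G] are integrable near [0]. *)

(** * Uniqueness of the Laplace transform *)

Section laplace_uniqueness.
Context {R : realType}.
Local Notation mu := (@lebesgue_measure R).
Implicit Types phi : R -> R.

(** An interval of positive length has positive measure, so it cannot lie inside the exceptional
    null set. *)
Lemma ae_exists_itv (Q : R -> Prop) (a b : R) : a < b ->
  {ae mu, forall s, Q s} -> exists2 s, a < s < b & Q s.
Proof.
move=> ab [N [mN N0 QN]]; apply: contrapT => /forall2NP nQ.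
have abN : [set` `]a, b[] `<=` N.
  move=> s /=; rewrite in_itv/= => sab; apply: QN => /= Qs.
  by have [|] := nQ s.
have : (mu [set` `]a, b[] <= mu N)%E.
  by apply: le_measure => //; rewrite inE.
by rewrite N0 lebesgue_measure_itv/= lte_fin ab -EFinB lee_fin leNgt subr_gt0 ab.
Qed.

Lemma ae_laplace_eq0 phi :
  (forall s, 0 < s ->
    mu.-integrable `]0, +oo[ (fun x => (expR (- (s * x)) * phi x)%:E)) ->
  {ae mu, forall s, 0 < s ->
    (\int[mu]_(x in `]0%R, +oo[) (expR (- (s * x)) * phi x)%:E = 0)%E} ->
  forall s, 0 < s ->
    (\int[mu]_(x in `]0%R, +oo[) (expR (- (s * x)) * phi x)%:E = 0)%E.
Proof.
move=> iphi ae0 s s0.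
have /choice[u_ us] : forall n : nat, exists r, s < r < s + n.+1%:R^-1 /\
    (\int[mu]_(x in `]0%R, +oo[) (expR (- (r * x)) * phi x)%:E = 0)%E.
  move=> n; have sn : s < s + n.+1%:R^-1 by rewrite ltrDl invr_gt0.
  have [r srn r0] := ae_exists_itv sn ae0.
  exists r; split => //; apply: r0.
  by case/andP: srn => + _; apply: lt_trans.
have u0 n : 0 < u_ n by have [/andP[+ _] _] := us n; apply: lt_trans.
have us_cvg : u_ n @[n --> \oo] --> s.
  apply: (@squeeze_cvgr _ _ _ _ (cst s) (fun n => s + n.+1%:R^-1)).
  - by near=> n; have [/andP[/ltW -> /ltW ->] _] := us n.
  - exact: cvg_cst.
  - by rewrite -[X in _ --> X]addr0; apply: cvgD; [exact: cvg_cst|exact: cvg_harmonic].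
have mD : measurable (`]0, +oo[%classic : set (measurableTypeR R)) by [].
suff : (\int[mu]_(x in `]0%R, +oo[) (expR (- (u_ n * x)) * phi x)%:E)%E @[n --> \oo] -->
  (\int[mu]_(x in `]0%R, +oo[) (expR (- (s * x)) * phi x)%:E)%E.
  under eq_fun do rewrite (us _).2.
  by move=> H; apply/esym; apply: (cvg_unique _ _ H) => //; exact: cvg_cst.
have [||_ _//] := @dominated_convergence _ _ _ mu _ mD
  (fun n x => (expR (- (u_ n * x)) * phi x)%:E)
  (fun x => (expR (- (s * x)) * phi x)%:E)
  (fun x => `|(expR (- (s * x)) * phi x)%:E|%E)
  (fun n => measurable_int _ (iphi _ (u0 n))) (measurable_int _ (iphi _ s0))
  _ (integrable_abse (iphi _ s0)) _.
- apply: aeW => x _; apply: cvg_EFin; first exact: nearW.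
  apply: cvgM; last exact: cvg_cst.
  apply: continuous_cvg; first exact: continuous_expR.
  by apply: cvgN; apply: cvgM => //; exact: cvg_cst.
- apply: aeW => x n /=; rewrite in_itv/= andbT => x0; rewrite lee_fin !normrM.
  rewrite ler_wpM2r// !ger0_norm ?expR_ge0// ler_expR lerN2 ler_pM2r//.
  by have [/andP[/ltW]] := us n.
Unshelve. all: by end_near. Qed.

(** Multiplication by [1 - expR (- (n%:R * x))] replaces the transform at [s] by its difference with
    the transform at [s + n], and both vanish by induction on [N]. *)
Lemma laplace_expM_eq0 phi :
  (forall s, 0 < s ->
    mu.-integrable `]0, +oo[ (fun x => (expR (- (s * x)) * phi x)%:E)) ->
  (forall s, 0 < s ->
    (\int[mu]_(x in `]0%R, +oo[) (expR (- (s * x)) * phi x)%:E = 0)%E) ->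
  forall (N n : nat) s, 0 < s ->
    mu.-integrable `]0, +oo[
      (fun x => ((1 - expR (- (n%:R * x))) ^+ N * (expR (- (s * x)) * phi x))%:E) /\
    (\int[mu]_(x in `]0%R, +oo[)
      ((1 - expR (- (n%:R * x))) ^+ N * (expR (- (s * x)) * phi x))%:E = 0)%E.
Proof.
have mD : measurable (`]0, +oo[%classic : set (measurableTypeR R)) by [].
move=> iphi phi0 N n; elim: N => [|N IH] s s0.
  split; first by move: (iphi _ s0); apply: eq_integrable => // x _; rewrite expr0 mul1r.
  by under eq_integral do rewrite expr0 mul1r; exact: phi0.
have sn : 0 < s + n%:R by rewrite ltr_wpDr.
have [i1 z1] := IH _ s0; have [i2 z2] := IH _ sn.
have E x : ((1 - expR (- (n%:R * x))) ^+ N.+1 * (expR (- (s * x)) * phi x))%:E =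
   (((1 - expR (- (n%:R * x))) ^+ N * (expR (- (s * x)) * phi x))%:E -
    ((1 - expR (- (n%:R * x))) ^+ N * (expR (- ((s + n%:R) * x)) * phi x))%:E)%E.
  rewrite -EFinB; congr EFin; rewrite exprS (mulrDl s) opprD expRD; ring.
split; first by move: (integrableB mD i1 i2); apply: eq_integrable => // x _; rewrite E.
by under eq_integral do rewrite E; rewrite integralB// z1 z2 subee.
Qed.

Lemma bernoulli_ineq (y : R) N : 0 <= y <= 1 -> 1 - N%:R * y <= (1 - y) ^+ N.
Proof.
move=> /andP[y0 y1]; elim: N => [|N IH]; first by rewrite mul0r subr0 expr0.
rewrite exprS; apply: (@le_trans _ _ ((1 - y) * (1 - N%:R * y))); last first.
  by rewrite ler_wpM2l// subr_ge0.
have : 0 <= N%:R * y * y by rewrite !mulr_ge0.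
by rewrite -natr1; lra.
Qed.

(* These functions are linear combinations of exponentials, so they are
   orthogonal to a function with vanishing Laplace transform, and they
   approximate the indicator of [(c, +oo)]. *)
Lemma cvg_gumbel_indic (c x : R) : 0 < x -> x != c ->
  (1 - expR (- (n%:R * x))) ^+ (Num.truncn (expR (n%:R * c))) @[n --> \oo] -->
  ((c < x)%R%:R : R).
Proof.
move=> x0 xc.
have D (t : R) : 0 < t -> expR (- (n%:R * t)) @[n --> \oo] --> (0 : R).
  move=> t0; apply: (@cvg_comp _ _ _ (fun n : nat => n%:R * t) (fun z => expR (- z))
    _ (pinfty_nbhs R)); last exact: cvgr_expR.
  apply: (@cvg_comp _ _ _ (fun n : nat => n%:R : R) (fun z => z * t)
    _ (pinfty_nbhs R)); first exact: cvgr_idn.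
  exact: gt0_cvgMly.
have y01 n : 0 <= expR (- (n%:R * x)) <= 1.
  by rewrite expR_ge0/= -expR0 ler_expR oppr_le0 mulr_ge0// ltW.
(* With [y = expR (- (n%:R * x))] and [N] the integer part of [expR (n%:R * c)], the product [N * y]
   is of order [expR (- (n%:R * (x - c)))], so the sign of [x - c] decides the limit of
   [(1 - y) ^+ N]. *)
have yM n : expR (- (n%:R * x)) * expR (n%:R * c) = expR (- (n%:R * (x - c))).
  by rewrite -expRD; congr expR; ring.
have Nle n : (Num.truncn (expR (n%:R * c)))%:R <= expR (n%:R * c) :> R.
  by rewrite truncn_le expR_ge0.
move: xc; rewrite neq_lt => /orP[xc|cx].
  rewrite ltNge (ltW xc)/=.
  have cx0 : 0 < c - x by rewrite subr_gt0.
  apply: (squeeze_cvgr _ (@cvg_cst _ _ _ _ _) (D _ cx0)); near=> n.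
  have /andP[y0 y1] := y01 n; set y := expR (- (n%:R * x)) in y0 y1 *.
  set N := Num.truncn _.
  rewrite exprn_ge0 ?subr_ge0//=.
  (* For [x < c] the chain is [(1 - y) ^+ N <= expR (- (N * y)) <= expR (- (n * (c - x)))]. The
     second inequality uses [expR (n * c) < N + 1] and [y <= 1], so that [y * expR (n * c) <= N * y
     + 1 <= expR (N * y)]. *)
  apply: (@le_trans _ _ (expR (- (N%:R * y)))).
    rewrite -mulrN expRM_natl lerXn2r ?nnegrE ?subr_ge0 ?expR_ge0//.
    exact: expR_ge1Dx.
  rewrite !expRN lef_pV2 ?posrE ?expR_gt0//.
  apply: le_trans (expR_ge1Dx _).
  have := ltW (truncnS_gt (expR (n%:R * c))); rewrite -/N -natr1.
  move=> /(ler_wpM2l y0); rewrite yM -opprB mulrN opprK => /le_trans; apply.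
  by rewrite mulrDr mulr1 mulrC addrC lerD2r.
rewrite cx/=.
have xc0 : 0 < x - c by rewrite subr_gt0.
have H : 1 - expR (- (n%:R * (x - c))) @[n --> \oo] --> (1 : R).
  by rewrite -[X in _ --> X]subr0; apply: cvgB; [exact: cvg_cst|exact: D].
apply: (squeeze_cvgr _ H (@cvg_cst _ _ _ _ _)); near=> n.
have /andP[y0 y1] := y01 n.
rewrite exprn_ile1 ?subr_ge0// ?gerBl// andbT.
apply: le_trans (bernoulli_ineq _ (y01 n)).
by rewrite lerD2l lerN2 -yM mulrC ler_wpM2l.
Unshelve. all: by end_near. Qed.

(** Approximating the indicator of [(c, +oo)] by combinations of exponentials shows that all tail
    integrals of [psi] vanish. Its primitive is then zero, and Lebesgue differentiation finishes. *)
Lemma laplace_unique phi :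
  (forall s, 0 < s ->
    mu.-integrable `]0, +oo[ (fun x => (expR (- (s * x)) * phi x)%:E)) ->
  {ae mu, forall s, 0 < s ->
    (\int[mu]_(x in `]0%R, +oo[) (expR (- (s * x)) * phi x)%:E = 0)%E} ->
  {ae mu, forall x, 0 < x -> phi x = 0}.
Proof.
move=> iphi /(ae_laplace_eq0 iphi) phi0.
(* The weight makes the function integrable on the whole half-line, which [phi] itself need not
   be. *)
pose psi x := expR (- (1 * x)) * phi x.
have ipsi : mu.-integrable `]0, +oo[ (EFin \o psi) by exact: iphi.
have mD : measurable (`]0, +oo[%classic : set (measurableTypeR R)) by [].
have psic c : 0 < c -> (\int[mu]_(x in `]c, +oo[) (psi x)%:E = 0)%E.
  move=> c0.
  pose T n x : R := (1 - expR (- (n%:R * x))) ^+ (Num.truncn (expR (n%:R * c))).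
  have [||||_ _] := @dominated_convergence _ _ _ mu _ mD
    (fun n x => (T n x * psi x)%:E) (fun x => (((c < x)%R%:R : R) * psi x)%:E)
    (fun x => `|(psi x)%:E|%E) _ _ _ (integrable_abse ipsi) _.
  - move=> n; exact: measurable_int _ (laplace_expM_eq0 iphi phi0 _ n ltr01).1.
  - apply/measurable_EFinP; apply: measurable_funM; last first.
      by have /measurable_EFinP := measurable_int _ ipsi.
    rewrite (_ : (fun x => _) = \1_`]c, +oo[); first exact: measurable_indic.
    by apply/funext => x; rewrite indicE mem_setE in_itv/= andbT.
  - exists [set c]; split => //; first exact: lebesgue_measure_set1.
    move=> x /=; apply: contra_notP => /eqP xc; rewrite in_itv/= andbT => x0.
    apply: cvg_EFin; first exact: nearW.
    by apply: cvgM; [exact: cvg_gumbel_indic|exact: cvg_cst].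
  - apply: aeW => x n /=; rewrite in_itv/= andbT => x0.
    have /andP[y0 y1] : 0 <= expR (- (n%:R * x)) <= 1.
      by rewrite expR_ge0/= -expR0 ler_expR oppr_le0 mulr_ge0// ltW.
    rewrite lee_fin normrM ler_piMl//.
    by rewrite ger0_norm ?exprn_ge0 ?exprn_ile1 ?subr_ge0//; lra.
  rewrite /= [X in X @ _ --> _ -> _](_ : _ = cst 0%E); last first.
    apply/funext => n /=; pose N := Num.truncn (expR (n%:R * c)).
    by have [_ ->] := laplace_expM_eq0 iphi phi0 N n ltr01.
  move=> H; have := cvg_unique _ H (@cvg_cst _ _ _ _ _); rewrite /cst => H0.
  rewrite -{}H0//.
  rewrite (_ : `]c, +oo[ = `]0, +oo[ `&` `]c, +oo[)%classic; last first.
    apply/seteqP; split => x /=; rewrite !in_itv/= !andbT; last by case.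
    by move=> cx; split => //; exact: lt_trans cx.
  rewrite integral_mkcondr; apply: eq_integral => x _.
  by rewrite patchE mem_setE in_itv/= andbT; case: ifPn; rewrite ?mul1r ?mul0r.
pose f := psi \_ `]0, +oo[.
have If : mu.-integrable setT (EFin \o f).
  rewrite /f -restrict_EFin; apply/integrable_restrict => //.
  by rewrite setTI.
have Ify y : mu.-integrable `]-oo, y] (EFin \o f) by exact: integrableS If.
(* Almost everywhere, [f] is the derivative of its primitive from [-oo]; it remains to see that this
   primitive is the zero function. *)
have := @FTC1Ny _ f Ify (integrable_locally_restrict mD ipsi).
rewrite (_ : (fun y => _) = cst 0); last first.
  apply/funext => y; rewrite /f -Rintegral_mkcondr /Rintegral.
  have [y0|y0] := leP y 0.
    rewrite (_ : _ `&` _ = set0) ?integral_set0//.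
    apply/seteqP; split => x //=; rewrite !in_itv/= andbT => -[xy x0].
    by have := lt_le_trans x0 (le_trans xy y0); rewrite ltxx.
  (* The integral over [(0, y]] is the full one, zero by [phi0] at [1], minus the tail, zero by
     [psic]. *)
  have E : (`]0, +oo[ = (`]-oo, y] `&` `]0, +oo[) `|` `]y, +oo[)%classic.
    apply/seteqP; split => x /=; rewrite !in_itv/= !andbT.
      by move=> x0; have [xy|yx] := leP x y; [left|right].
    by move=> [[]//|]; exact: lt_trans.
  have := phi0 _ ltr01; rewrite -/(psi _).
  rewrite {1}E integral_setU//=.
  - by rewrite psic// adde0 => H; exact: (congr1 fine H).
  - by apply: measurableI.
  - by rewrite -E; exact: (measurable_int _ ipsi).
  - apply/disj_setPS => x /=; rewrite !in_itv/= !andbT => -[[xy _] yx].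
    by have := le_lt_trans xy yx; rewrite ltxx.
apply: filterS; first exact: (ae_filter_ringOfSetsType mu).
move=> x [_ + x0]; rewrite derive1_cst /f patchE mem_setE in_itv/= andbT x0.
by move/esym/eqP; rewrite mulf_eq0 gt_eqF ?expR_gt0//= => /eqP.
Qed.

End laplace_uniqueness.

(** * From the transform identity to the integral formula *)

Section fubini_primitive.
Context {R : realType}.
Local Notation mu := (@lebesgue_measure R).
Local Notation T := (measurableTypeR R).

(** Both sides are iterated integrals of [w t * u x] over the triangle [0 < x < t]. As [w] is
    nonnegative, integrating the absolute value in [t] first gives [|u x| * W x], so integrability
    of [u * W] is what Fubini requires. *)
Lemma fubini_primitive (u w W : R -> R) :
  measurable_fun (`]0, +oo[%classic : set T) u ->
  measurable_fun (`]0, +oo[%classic : set T) w ->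
  (forall t, 0 < t -> 0 <= w t) ->
  (forall x, 0 < x -> (\int[mu]_(t in `]x, +oo[) (w t)%:E = (W x)%:E)%E) ->
  (forall t, 0 < t -> mu.-integrable `]0, t[ (EFin \o u)) ->
  mu.-integrable `]0, +oo[ (fun x => (u x * W x)%:E) ->
  mu.-integrable `]0, +oo[ (fun t => (w t * \int[mu]_(x in `]0, t[) u x)%:E) /\
  (\int[mu]_(t in `]0%R, +oo[) (w t * (\int[mu]_(x in `]0%R, t[) u x)%R)%:E =
   \int[mu]_(x in `]0%R, +oo[) (u x * W x)%:E)%E.
Proof.
move=> meas_u mw w0 wW iu iuW.
pose D : set T := `]0, +oo[%classic.
have mD : measurable D by exact: measurable_itv.
have DE x : (x \in D) = (0 < x) by rewrite mem_setE in_itv/= andbT.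
(* The integrand on the triangle, extended by zero to the whole plane; [z.1] is [t] and [z.2] is
   [x]. *)
pose f (z : T * T) : \bar R := ((w \_ D) z.1 * ((u \_ D) z.2 * (z.2 < z.1)%R%:R))%:E.
have mf : measurable_fun setT f.
  apply/measurable_EFinP; apply: measurable_funM.
    apply: measurableT_comp; last exact: measurable_fst.
    exact/(measurable_restrictT _ mD).
  apply: measurable_funM.
    apply: measurableT_comp; last exact: measurable_snd.
    exact/(measurable_restrictT _ mD).
  have -> : (fun z : T * T => ((z.2 < z.1)%R%:R : R)) = \1_[set z : T * T | z.2 < z.1].
    by apply/funext => z; rewrite indicE mem_setE.
  apply: measurable_indic; rewrite -[X in measurable X]setTI.
  exact: (measurable_fun_ltr measurable_snd measurable_fst measurableT (Y := [set true])).
have Wint x : 0 < x ->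
    (\int[mu]_t ((w \_ D) t * (x < t)%R%:R)%:E = (W x)%:E)%E.
  move=> x0; rewrite -wW// [RHS]integral_mkcond; apply: eq_integral => t _.
  rewrite !patchE DE mem_setE in_itv/= andbT.
  case: ifPn => t0; case: ltP => xt; rewrite ?mulr1 ?mulr0 ?mul0r//.
  by move: t0; rewrite (lt_trans x0 xt).
have mwx x : measurable_fun setT (fun t : T => ((w \_ D) t * (x < t)%R%:R)%:E).
  apply/measurable_EFinP; apply: measurable_funM.
    exact/(measurable_restrictT _ mD).
  rewrite (_ : (fun t => _) = \1_`]x, +oo[); first exact: measurable_indic.
  by apply/funext => t; rewrite indicE mem_setE in_itv/= andbT.
have wx0 x t : 0 <= (w \_ D) t * (x < t)%R%:R.
  by rewrite mulr_ge0// patchE DE; case: ifPn => // t0; exact: w0.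
have W0 x : 0 < x -> 0 <= W x.
  move=> x0; rewrite -lee_fin -Wint//; apply: integral_ge0 => t _.
  by rewrite lee_fin.
have absu : (\int[mu]_x \int[mu]_t `|f (t, x)| = \int[mu]_(x in D) `|(u x * W x)%:E|)%E.
  rewrite [RHS]integral_mkcond; apply: eq_integral => x _.
  rewrite patchE DE; case: ifPn => x0; last first.
    rewrite integral0_eq// => t _.
    by rewrite /f/= [(u \_ D) x]patchE DE (negbTE x0) mul0r mulr0 normr0.
  rewrite /= normrM (ger0_norm (W0 _ x0)) EFinM -Wint// -ge0_integralZl//; last first.
  - by move=> t _; rewrite lee_fin.
  apply: eq_integral => t _; rewrite -EFinM /f/= [in RHS]mulrC; congr EFin.
  rewrite [(u \_ D) x]patchE DE x0 !normrM (ger0_norm (ler0n _ _)) ger0_norm; last first.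
    by rewrite patchE DE; case: ifPn => // t0; exact: w0.
  ring.
have fint : (mu \x mu)%E.-integrable setT f.
  by apply/integrable21ltyP => //; rewrite absu; case/integrableP: iuW.
have K t : (\int[mu]_x f (t, x))%E =
    (((fun t => (w t * \int[mu]_(x in `]0, t[) u x)%:E) \_ D) t)%E.
  rewrite [in RHS]patchE DE; case: ifPn => t0; last first.
    by rewrite integral0_eq// => x _; rewrite /f/= patchE DE (negbTE t0) mul0r.
  under eq_integral do rewrite /f/= [(w \_ D) t]patchE DE t0 EFinM.
  have E x : ((u \_ D) x * (x < t)%R%:R)%:E =
      ((EFin \o u) \_ (`]0, t[%classic : set T)) x.
    rewrite !patchE DE mem_setE in_itv/=.
    by case: ltP => _ /=; case: ltP => _ /=; rewrite ?mulr1 ?mulr0 ?mul0r.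
  under eq_integral do rewrite E.
  have iut := iu _ t0.
  rewrite integralZl//; last by apply/integrable_restrict; rewrite ?setTI.
  rewrite -integral_mkcond EFinM /Rintegral fineK//.
  exact: integrable_fin_num.
split.
  have := integrable_fubini_F fint; rewrite /fubini_F.
  under eq_fun do rewrite K.
  by move=> /((integrable_restrict mu mD measurableT _).2); rewrite setTI.
have := Fubini fint; under eq_integral do rewrite K.
rewrite -integral_mkcond => ->.
rewrite [RHS]integral_mkcond; apply: eq_integral => x _.
rewrite [in RHS]patchE DE; case: ifPn => x0; last first.
  rewrite integral0_eq// => t _.
  by rewrite /f/= [(u \_ D) x]patchE DE (negbTE x0) mul0r mulr0.
rewrite EFinM -Wint// -integralZl//; last first.
  apply/integrableP; split => //.
  under eq_integral do rewrite gee0_abs ?lee_fin//.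
  by rewrite Wint// ltry.
apply: eq_integral => t _; rewrite -EFinM /f/= [(u \_ D) x]patchE DE x0; congr EFin; ring.
Qed.
End fubini_primitive.

(** * Tail integrals of the exponential and power kernels *)

Section tails.
Context {R : realType}.
Local Notation mu := (@lebesgue_measure R).
Local Notation T := (measurableTypeR R).

(** With this kernel [fubini_primitive] relates the Laplace transform of a primitive to that of the
    integrand. *)
Lemma integral_expR_tail (s x : R) : 0 < s -> 0 <= x ->
  (\int[mu]_(t in `]x, +oo[) (s * expR (- (s * t)))%:E = (expR (- (s * x)))%:E)%E.
Proof.
move=> s0 x0.
have cf : continuous (fun t : R => expR (- (s * t))).
  move=> t; apply: continuous_comp; last exact: continuous_expR.
  by apply: cvgN; apply: cvgM; [exact: cvg_cst|exact: cvg_id].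
have E : (fun t => - expR (- (s * t))) = (fun t => - expR (- s * t)).
  by apply/funext => t; rewrite mulNr.
have csf : continuous (fun t : R => s * expR (- (s * t))).
  by move=> t; apply: cvgM; [exact: cvg_cst|exact: cf].
rewrite integral_itv_obnd_cbnd; last first.
  by apply/measurable_EFinP; apply: measurable_funTS; exact: continuous_measurable_fun.
rewrite (@ge0_continuous_FTC2y _ _ (fun t => - expR (- (s * t))) _ 0).
- by rewrite sub0e -EFinN opprK.
- by move=> t _; rewrite mulr_ge0 ?expR_ge0// ltW.
- exact: continuous_subspaceT.
- rewrite -[X in _ --> X]oppr0; apply: cvgN.
  apply: (@cvg_comp _ _ _ (fun t : R => s * t) (fun z => expR (- z)) _ (pinfty_nbhs R)).
    exact: gt0_cvgMry.
  exact: cvgr_expR.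
- by move=> t _; rewrite E; exact: ex_derive.
- by apply: cvg_at_right_filter; apply: cvgN; exact: cf.
- move=> t; rewrite in_itv/= andbT => xt; have t0 := le_lt_trans x0 xt.
  rewrite E derive1_exponential_pdf ?in_itv/= ?t0//.
  by rewrite exponential_pdfE ?ltW// mulNr.
Qed.

Lemma integral_powR_tail (a x y : R) : 0 <= a -> 0 < x -> 0 < y ->
  (\int[mu]_(t in `]y, +oo[) (if t < x then a * t `^ (a - 1) else 0)%:E =
   (if y < x then x `^ a - y `^ a else 0)%:E)%E.
Proof.
move=> a0 x0 y0; case: ltP => [yx|xy]; last first.
  rewrite integral0_eq// => t /=; rewrite in_itv/= andbT => yt.
  by rewrite ltNge (le_trans xy (ltW yt)).
transitivity (\int[mu]_(t in `]y, x[) (a * t `^ (a - 1))%:E)%E.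
  rewrite [LHS]integral_mkcond [RHS]integral_mkcond; apply: eq_integral => t _.
  rewrite !patchE !mem_setE !in_itv/= andbT.
  by case: (ltP y t) => //= yt; case: ltP.
have cf t : 0 < t -> {for t, continuous (fun t : R => a * t `^ (a - 1))}.
  move=> t0; apply: cvgM; first exact: cvg_cst.
  by have [/derivable1_diffP/differentiable_continuous] := is_derive1_powR (a - 1) t0.
have cF t : 0 < t -> {for t, continuous (@powR R ^~ a)}.
  move=> t0.
  by have [/derivable1_diffP/differentiable_continuous] := is_derive1_powR a t0.
rewrite -(@integral_itv_bndoo _ _ _ _ true false); last first.
  apply/measurable_EFinP; apply: open_continuous_measurable_fun => //.
  move=> t /[!inE]/=; rewrite in_itv/= => /andP[yt _]; apply: cf.
  exact: lt_trans yt.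
rewrite (@continuous_FTC2 _ _ (@powR R ^~ a))//.
- apply: continuous_in_subspaceT => t /[!inE]/=; rewrite in_itv/= => /andP[yt _].
  by apply: cf; exact: lt_le_trans yt.
- split.
  + move=> t; rewrite in_itv/= => /andP[yt _].
    by have [] := is_derive1_powR a (lt_trans y0 yt).
  + by apply: cvg_at_right_filter; exact: cF.
  + by apply: cvg_at_left_filter; exact: cF.
- move=> t; rewrite in_itv/= => /andP[yt _].
  by rewrite powR_derive1// in_itv/= andbT (lt_trans y0 yt).
Qed.

End tails.

Lemma measurable_inv {R : realType} :
  measurable_fun setT (fun x : measurableTypeR R => x^-1 : R).
Proof.
rewrite -(setUv [set 0%R : R]); apply/measurable_funU => //.
  exact: measurableC.
split; first exact: measurable_fun_set1.
apply: open_continuous_measurable_fun; first exact/closed_openC/closed_eq.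
move=> x /[!inE]/= /eqP x0; apply: cvgV => //.
Qed.

(** * The first-order equation in integrated form *)

Section laplace_ode.
Context {R : realType}.
Local Notation mu := (@lebesgue_measure R).
Local Notation T := (measurableTypeR R).
Variables (a : R) (G k : R -> R).
Hypotheses (a0 : 0 <= a) (G0 : forall x, 0 < x -> 0 <= G x).
Hypothesis mG : measurable_fun (`]0, +oo[%classic : set T) G.
Hypothesis ik : forall s, 0 < s ->
  mu.-integrable `]0, +oo[ (fun x => (expR (- (s * x)) * k x)%:E).
Hypothesis kG : {ae mu, forall s, 0 < s ->
  (\int[mu]_(x in `]0%R, +oo[) (expR (- (s * x)) * k x)%:E =
   \int[mu]_(x in `]0%R, +oo[) (expR (- (s * x)) * ((a / x + s) * G x))%:E)%E}.

Let D : set T := `]0, +oo[%classic.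
Let mD : measurable D. Proof. exact: measurable_itv. Qed.
Let DP (x : T) : D x -> 0 < x.
Proof. by rewrite /D/= in_itv/= andbT. Qed.
Let DE (x : T) : (x \in D) = (0 < x).
Proof. by rewrite mem_setE in_itv/= andbT. Qed.

Let mexp s : measurable_fun D (fun x : T => expR (- (s * x))).
Proof.
apply: measurable_funTS; apply: measurableT_comp; first exact: measurable_expR.
by apply: measurableT_comp; [exact: oppr_measurable|exact: measurable_funM].
Qed.

Let mVG : measurable_fun D (fun x => a / x * G x).
Proof.
apply: measurable_funM mG; apply: measurable_funM => //.
by apply: measurable_funTS; exact: measurable_inv.
Qed.

(** At some [r < s] the identity [kG] holds, so the transform of [(a / x + r) * G] is finite there.
    Both terms of this sum are nonnegative, hence each is dominated by it; the bound for [G] alone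
    costs a factor [r^-1]. *)
Let iexpG s : 0 < s ->
  mu.-integrable D (fun x => (expR (- (s * x)) * G x)%:E) /\
  mu.-integrable D (fun x => (expR (- (s * x)) * (a / x * G x))%:E).
Proof.
move=> s0; have [r /andP[r0 rs] kGr] := ae_exists_itv s0 kG.
have ir : mu.-integrable D (fun x => (expR (- (r * x)) * ((a / x + r) * G x))%:E).
  apply/integrableP; split.
    apply/measurable_EFinP; apply: measurable_funM; first exact: mexp.
    rewrite (_ : (fun x => _) = (fun x => a / x * G x) \+ (fun x => r * G x)).
      apply: measurable_funD mVG _; exact: measurable_funM.
    by apply/funext => x /=; rewrite mulrDl.
  have -> : (\int[mu]_(x in D) `|(expR (- (r * x)) * ((a / x + r) * G x))%:E| =
      \int[mu]_(x in D) (expR (- (r * x)) * ((a / x + r) * G x))%:E)%E.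
    apply: eq_integral => x; rewrite DE => x0; rewrite gee0_abs// lee_fin.
    by rewrite mulr_ge0 ?expR_ge0// mulr_ge0 ?G0// addr_ge0 ?divr_ge0// ltW.
  by rewrite -kGr// ltey_eq (integrable_fin_num mD (ik r0)).
have ersx (x : T) : D x -> expR (- (s * x)) <= expR (- (r * x)).
  by move=> /DP x0; rewrite ler_expR lerN2 ler_pM2r// ltW.
split.
- have := integrableZl mD r^-1 ir; apply: le_integrable => //.
    by apply/measurable_EFinP; apply: measurable_funM mG; exact: mexp.
  move=> x Dx; have x0 := DP Dx; rewrite -EFinM lee_fin.
  have Gx := G0 x0; have ax : 0 <= a / x by rewrite divr_ge0// ltW.
  rewrite !ger0_norm ?mulr_ge0 ?invr_ge0 ?expR_ge0 ?addr_ge0 ?(ltW r0) ?(ltW x0)//.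
  rewrite mulrCA; apply: ler_pM => //; first exact: ersx.
  rewrite mulrA ler_peMl// mulrDr mulVf ?gt_eqF// lerDr.
  by rewrite mulr_ge0 ?invr_ge0// ltW.
- move: ir; apply: le_integrable => //.
    by apply/measurable_EFinP; apply: measurable_funM mVG; exact: mexp.
  move=> x Dx; have x0 := DP Dx; rewrite lee_fin.
  have Gx := G0 x0; have ax : 0 <= a / x by rewrite divr_ge0// ltW.
  rewrite !ger0_norm ?mulr_ge0 ?invr_ge0 ?expR_ge0 ?addr_ge0 ?(ltW r0) ?(ltW x0)//.
  apply: ler_pM; [exact: expR_ge0|exact: mulr_ge0|exact: ersx|].
  by rewrite ler_wpM2r// lerDl ltW.
Qed.

Let u x := k x - a / x * G x.
Let K t := \int[mu]_(x in `]0, t[) u x.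

Let iexpu s : 0 < s -> mu.-integrable D (fun x => (expR (- (s * x)) * u x)%:E).
Proof.
move=> s0; have := integrableB mD (ik s0) (iexpG s0).2.
by apply: eq_integrable => // x _; rewrite -EFinB mulrBr.
Qed.

Let meas_u : measurable_fun D u.
Proof.
have /measurable_EFinP H := measurable_int _ (iexpu ltr01).
have E : u = (fun x => expR (1 * x) * (expR (- (1 * x)) * u x)).
  by apply/funext => x; rewrite mulrA -expRD subrr expR0 mul1r.
rewrite E; apply: measurable_funM H.
apply: measurable_funTS; apply: measurableT_comp; first exact: measurable_expR.
exact: measurable_funM.
Qed.

(** On [(0, t)] the weight [expR (- x)] is at least [expR (- t)], so removing it costs only the
    constant [expR t]. *)
Let iloc (f : R -> R) t : measurable_fun D f ->
  mu.-integrable D (fun x => (expR (- (1 * x)) * f x)%:E) ->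
  mu.-integrable (`]0, t[%classic : set T) (EFin \o f).
Proof.
move=> mf ief; have sub : `]0, t[%classic `<=` D.
  by move=> x; rewrite /D/= !in_itv/= andbT => /andP[].
have mt : measurable (`]0, t[%classic : set T) by [].
have := integrableZl mt (expR t) (integrableS mD mt sub ief).
apply: le_integrable => //.
  by apply/measurable_EFinP; exact: measurable_funS mf.
move=> x /=; rewrite in_itv/= => /andP[x0 xt].
rewrite lee_fin mulrA -expRD normrM ler_peMl// ger0_norm ?expR_ge0//.
by rewrite -[leLHS]expR0 ler_expR mul1r subr_ge0 ltW.
Qed.

Let iu t : mu.-integrable (`]0, t[%classic : set T) (EFin \o u).
Proof. exact: iloc meas_u (iexpu ltr01). Qed.

(** [fubini_primitive] with the kernel [s * expR (- (s * t))] makes [s] times the transform of [K]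
    equal to the transform of [u]. By [kG] this is [s] times the transform of [G] for almost every
    [s], and uniqueness applies to [K - G]. *)
Let KG : {ae mu, forall x, 0 < x -> K x = G x}.
Proof.
have H s (s0 : 0 < s) : mu.-integrable D (fun t => (s * expR (- (s * t)) * K t)%:E) /\
    (\int[mu]_(t in D) (s * expR (- (s * t)) * K t)%:E =
     \int[mu]_(x in D) (u x * expR (- (s * x)))%:E)%E.
  apply: fubini_primitive.
  - exact: meas_u.
  - by apply: measurable_funM => //; exact: mexp.
  - by move=> t _; rewrite mulr_ge0 ?expR_ge0// ltW.
  - by move=> x x0; rewrite integral_expR_tail// ltW.
  - by move=> t _; exact: iu.
  - by move: (iexpu s0); apply: eq_integrable => // x _; rewrite mulrC.
have iK s (s0 : 0 < s) : mu.-integrable D (fun t => (expR (- (s * t)) * K t)%:E).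
  have := integrableZl mD s^-1 (H s s0).1; apply: eq_integrable => // x _.
  by rewrite -EFinM -mulrA mulKf// gt_eqF.
have := @laplace_unique R (fun x => K x - G x) _ _.
have iphi s : 0 < s -> mu.-integrable D (fun x => (expR (- (s * x)) * (K x - G x))%:E).
  move=> s0; have := integrableB mD (iK s s0) (iexpG s0).1.
  by apply: eq_integrable => // x _; rewrite -EFinB mulrBr.
move=> /(_ iphi) HH; have {}HH := HH _.
apply: (@filterS _ _ (ae_filter_ringOfSetsType mu) _ _ _ (HH _)).
  by move=> x + x0 => /(_ x0)/eqP; rewrite subr_eq0 => /eqP.
apply: (@filterS _ _ (ae_filter_ringOfSetsType mu) _ _ _ kG) => s /[swap] s0 /(_ s0) kGs.
have [iGs iVs] := iexpG s0.
have e1 : (\int[mu]_(x in D) (expR (- (s * x)) * ((a / x + s) * G x))%:E =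
  \int[mu]_(x in D) (expR (- (s * x)) * (a / x * G x))%:E +
  s%:E * \int[mu]_(x in D) (expR (- (s * x)) * G x)%:E)%E.
  rewrite -integralZl// -integralD//; last exact: integrableZl.
  by apply: eq_integral => x _; rewrite -EFinM -EFinD; congr EFin; ring.
have e2 : (s%:E * \int[mu]_(t in D) (expR (- (s * t)) * K t)%:E =
  \int[mu]_(x in D) (expR (- (s * x)) * k x)%:E -
  \int[mu]_(x in D) (expR (- (s * x)) * (a / x * G x))%:E)%E.
  rewrite -integralB//; last exact: ik.
  rewrite -integralZl//; last exact: iK.
  under eq_integral do rewrite -EFinM mulrA.
  rewrite (H s s0).2; apply: eq_integral => x _; rewrite -EFinB /u; congr EFin; ring.
have fV := integrable_fin_num mD iVs.
have fG := integrable_fin_num mD iGs.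
have fK := integrable_fin_num mD (iK s s0).
transitivity (\int[mu]_(x in D) (expR (- (s * x)) * K x)%:E -
  \int[mu]_(x in D) (expR (- (s * x)) * G x)%:E)%E.
  rewrite -integralB//; last exact: iK.
  by apply: eq_integral => x _; rewrite mulrBr.
rewrite kGs e1 in e2.
move: e2.
rewrite -(fineK fV) -(fineK fG) -(fineK fK) -!EFinM -EFinD -!EFinB => -[] e2.
by congr EFin; apply: (mulfI (lt0r_neq0 s0)); rewrite mulrBr e2; ring.
Qed.

(** With the kernel [a * t]^ (a - 1)[on](0, x)[,]fubini_primitive[equates the integral of]t
    [^ a * (a / t * G t)] with [x]^ a * K x[minus the integral of]t [^ a * u t]. Moving the latter
    across and using [u + (a / t) * G = k] gives the claim. *)
Let powRK x : 0 < x -> \int[mu]_(t in `]0, x[) (t `^ a * k t) = x `^ a * K x.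
Proof.
move=> x0; pose I : set T := `]0, x[%classic.
have mI : measurable I by exact: measurable_itv.
have IE t : (t \in I) = (0 < t < x) by rewrite mem_setE in_itv.
have ID : I `<=` D by move=> t; rewrite /I /D/= !in_itv/= andbT => /andP[].
have le_powR t : 0 < t -> t < x -> t `^ a <= x `^ a.
  by move=> t0 tx; apply: ge0_ler_powR; rewrite ?nnegrE ?(ltW tx) ?(ltW t0) ?(ltW x0).
have ipow (f : R -> R) : mu.-integrable I (EFin \o f) ->
    mu.-integrable I (EFin \o (fun t => t `^ a * f t)).
  move=> If; have /measurable_EFinP mf := measurable_int _ If.
  have := integrableZl mI (x `^ a) If; apply: le_integrable => //.
    apply/measurable_EFinP; apply: measurable_funM mf.
    by apply: measurable_funTS; exact: measurable_powR.
  move=> t; rewrite /I/= in_itv/= => /andP[t0 tx].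
  by rewrite lee_fin !normrM ler_wpM2r// !ger0_norm ?powR_ge0// le_powR.
have iI := iu x.
have iVI : mu.-integrable I (EFin \o (fun t => a / t * G t)).
  exact: iloc mVG (iexpG ltr01).2.
pose w t := if t < x then a * t `^ (a - 1) else 0.
pose W y := if y < x then x `^ a - y `^ a else 0.
have mw : measurable_fun D w.
  apply: measurable_funTS; apply: measurable_fun_ifT => //.
    exact: measurable_fun_ltr.
  by apply: measurable_funM => //; exact: measurable_powR.
have iuW : mu.-integrable D (fun y => (u y * W y)%:E).
  have /(integrable_restrict mu mI mD) : mu.-integrable (D `&` I) (EFin \o u).
    by rewrite setIidr.
  move=> /(integrableZl mD (x `^ a)); apply: le_integrable => //.
    apply/measurable_EFinP; apply: measurable_funM => //.
    apply: measurable_funTS; apply: measurable_fun_ifT => //.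
      exact: measurable_fun_ltr.
    by apply: measurable_funB => //; exact: measurable_powR.
  move=> y Dy; have y0 := DP Dy; rewrite patchE IE y0/= /W.
  case: ltP => yx; last by rewrite mulr0 normr0 abse_ge0.
  rewrite lee_fin !normrM mulrC ler_wpM2r// !ger0_norm ?subr_ge0 ?powR_ge0 ?le_powR//.
  by rewrite gerBl powR_ge0.
have w0 t : 0 < t -> 0 <= w t.
  by move=> _; rewrite /w; case: ifP => // _; rewrite mulr_ge0// powR_ge0.
have [iwK] := fubini_primitive meas_u mw w0 (fun y y0 => integral_powR_tail a0 x0 y0)
  (fun t _ => iu t) iuW.
(* Under the integral [K] may be replaced by [G], since they agree almost everywhere, and [a * t]^
   (a - 1)[is]t [^ a * (a / t)]. *)
have -> : (\int[mu]_(t in `]0%R, +oo[) (w t * (\int[mu]_(x in `]0%R, t[) u x)%R)%:E =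
    \int[mu]_(t in I) (t `^ a * (a / t * G t))%:E)%E.
  rewrite -(setIidr ID) integral_mkcondr; apply: ae_eq_integral => //.
  - exact: measurable_int iwK.
  - apply/(measurable_restrict _ mI mD); rewrite setIidr//.
    exact: measurable_int (ipow _ iVI).
  - apply: (@filterS _ _ (ae_filter_ringOfSetsType mu) _ _ _ KG) => t Kt /DP t0.
    rewrite patchE IE t0/= /w -/(K t) Kt//; case: ltP => tx; last by rewrite mul0r.
    congr EFin; rewrite powRD; last by rewrite (gt_eqF t0) implybT.
    by rewrite powR_inv1 ?ltW//; ring.
have -> : (\int[mu]_(y in `]0%R, +oo[) (u y * W y)%:E =
    \int[mu]_(y in I) (x `^ a * u y - y `^ a * u y)%:E)%E.
  rewrite [LHS]integral_mkcond [RHS]integral_mkcond; apply: eq_integral => y _.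
  rewrite !patchE DE IE /W; case: ltP => //= y0; case: ltP => // yx.
    by congr EFin; ring.
  by rewrite mulr0.
move=> /(congr1 fine); rewrite -!/(Rintegral _ _ _) => E.
transitivity (\int[mu]_(t in I) (t `^ a * u t + t `^ a * (a / t * G t))).
  by apply: eq_Rintegral => t _; rewrite /u; ring.
rewrite RintegralD//; [|exact: ipow|exact: ipow].
rewrite E RintegralB//; [|exact: (integrableZl mI (x `^ a) iI)|exact: ipow].
by rewrite RintegralZl// /K addrC subrK.
Qed.

Lemma laplace_ode : {ae mu, forall x, 0 < x ->
  x `^ a * G x = \int[mu]_(t in `]0, x[) (t `^ a * k t)}.
Proof.
apply: (@filterS _ _ (ae_filter_ringOfSetsType mu) _ _ _ KG) => x + x0 => /(_ x0) <-.
by rewrite powRK.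
Qed.

End laplace_ode.

(** * The density of X / (X + Y) *)

Section ge0_integral_density.
Context d (T : measurableType d) (R : realType).
Variables (nu : {finite_measure set T -> \bar R})
          (mu : {sigma_finite_measure set T -> \bar R}) (f : T -> R).
Hypotheses (f0 : forall x, 0 <= f x) (mf : measurable_fun setT f).
Hypothesis nuE : forall A, measurable A ->
  nu A = (\int[mu]_(x in A) (f x)%:E)%E.

(** The Radon-Nikodym derivative of [nu] has the same integral as [f] over every measurable set, so
    the two agree almost everywhere, and the change of measure for the derivative carries over to
    [f]. *)
Lemma ge0_integral_density (g : T -> \bar R) :
  (forall x, 0 <= g x)%E -> measurable_fun setT g ->
  (\int[nu]_x g x = \int[mu]_x (g x * (f x)%:E))%E.
Proof.
move=> g0 mg.
have mf' : measurable_fun setT (EFin \o f) by exact/measurable_EFinP.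
have numu : nu `<< mu.
  apply/null_content_dominatesP => A mA A0; rewrite nuE//.
  by apply: null_set_integral => //; exact: measurable_funTS.
rewrite -(Radon_Nikodym_SigmaFinite.change_of_variables numu g0 measurableT mg).
have iRN := Radon_Nikodym_SigmaFinite.f_integrable numu.
apply: ge0_ae_eq_integral => //.
- by apply: emeasurable_funM => //; exact: measurable_int iRN.
- exact: emeasurable_funM.
- by move=> x _; rewrite mule_ge0// Radon_Nikodym_SigmaFinite.f_ge0.
- by move=> x _; rewrite mule_ge0// lee_fin.
- apply: ae_eqe_mul2l; apply: integral_ae_eq => // E _ mE.
  by rewrite -Radon_Nikodym_SigmaFinite.f_integral// nuE.
Qed.

End ge0_integral_density.

Section density_measure.
Context d (T : measurableType d) (R : realType).
Variables (mu : {measure set T -> \bar R}) (f : T -> R).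

(** The two proofs are arguments so that the structure of a finite measure can be attached to the
    term. *)
Definition density_measure (f0 : forall x, 0 <= f x)
  (intf : mu.-integrable setT (EFin \o f)) (A : set T) : \bar R :=
  (\int[mu]_(x in A) (f x)%:E)%E.

Variables (f0 : forall x, 0 <= f x) (intf : mu.-integrable setT (EFin \o f)).
Local Notation m := (density_measure f0 intf).

Let m0 : m set0 = 0%E.
Proof. by rewrite /density_measure integral_set0. Qed.

Let m_ge0 A : (0 <= m A)%E.
Proof. by apply: integral_ge0 => x _; rewrite lee_fin. Qed.

Let m_sigma_additive : semi_sigma_additive m.
Proof.
move=> /= F mF tF mUF; rewrite /density_measure; apply: cvg_toP.
  apply: ereal_nondecreasing_is_cvgn => k n kn.
  by apply: lee_sum_nneg_natr => // i _ _; exact: m_ge0.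
rewrite ge0_integral_bigcup//=.
- exact: measurable_funTS (measurable_int _ intf).
- by move=> x _; rewrite lee_fin.
Qed.

HB.instance Definition _ := isMeasure.Build _ _ _ m m0 m_ge0 m_sigma_additive.

Let m_fin : fin_num_fun m.
Proof.
move=> A mA; rewrite ge0_fin_numE//.
have /integrableP[mf] := intf; apply: le_lt_trans.
under [leRHS]eq_integral do rewrite gee0_abs ?lee_fin//.
by apply: ge0_subset_integral => // x _; rewrite lee_fin.
Qed.

HB.instance Definition _ := Measure_isFinite.Build _ _ _ m m_fin.

End density_measure.

(** * The substitution [z = c / (c + y)] between [(0, +oo)] and [(0, 1)] *)

Section ratio_change_of_variables.
Context {R : realType}.
Local Notation mu := (@lebesgue_measure R).
Local Notation T := (measurableTypeR R).
Variable c : R.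
Hypothesis c0 : 0 < c.

Lemma integral_ratio_density (b : R) : 0 <= b ->
  (\int[mu]_(y in `]b, +oo[) (c / (c + y) ^+ 2)%:E = (c / (c + b))%:E)%E.
Proof.
move=> b0.
have cx x : b <= x -> c + x != 0.
  by move=> bx; rewrite gt_eqF// ltr_wpDr// (le_trans b0).
have dF x : b <= x -> is_derive x 1 (fun x => - (c / (c + x))) (c / (c + x) ^+ 2).
  move=> bx; have cx0 := cx _ bx.
  have H1 : is_derive x (1 : R) (fun x : R => c + x) 1.
    have := is_deriveD (is_derive_cst c x (1 : R)) (is_derive_id x (1 : R)).
    by rewrite add0r.
  have := is_deriveZ (- c) (is_deriveV cx0 H1).
  rewrite (_ : _ \*: _ = (fun x => - (c / (c + x)))); last first.
    by apply/funext => y /=; rewrite /GRing.scale/= mulNr.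
  by rewrite /GRing.scale/= mulr1 mulrNN.
have cf x : b <= x -> {for x, continuous (fun x : R => c / (c + x) ^+ 2)}.
  move=> bx; apply: cvgM; first exact: cvg_cst.
  apply: cvgV; first by rewrite expf_neq0// cx.
  apply: (@cvg_comp _ _ _ (fun x => c + x) (fun z => z ^+ 2)); last first.
    exact: exprn_continuous.
  by apply: cvgD; [exact: cvg_cst|exact: cvg_id].
rewrite integral_itv_obnd_cbnd; last first.
  apply/measurable_EFinP; apply: open_continuous_measurable_fun => //.
  by move=> x /[!inE]/=; rewrite in_itv/= andbT => /ltW; exact: cf.
rewrite (@ge0_continuous_FTC2y _ _ (fun x => - (c / (c + x))) _ 0).
- by rewrite sub0e -EFinN opprK.
- by move=> x bx; rewrite divr_ge0 ?sqr_ge0// ltW.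
- apply: continuous_in_subspaceT => x /[!inE]/=; rewrite in_itv/= andbT; exact: cf.
- rewrite -[X in _ --> X]oppr0 -[X in - X](mulr0 c).
  apply: cvgN; apply: cvgM; first exact: cvg_cst.
  apply/gtr0_cvgV0; last by apply: cvg_addrl; exact: cvg_id.
  by near=> x; rewrite ltr_wpDr// ltW.
- by move=> x /ltW /dF[].
- apply: cvg_at_right_filter.
  by have [/derivable1_diffP/differentiable_continuous] := dF _ (lexx b).
- by move=> x; rewrite in_itv/= andbT => /ltW /dF H; rewrite derive1E derive_val.
Unshelve. all: by end_near. Qed.

(** The absolute value of the derivative of [c / (c + y)], that is, the density of [c / U - c] for
    [U] uniform on [(0, 1)]. *)
Definition ratio_density (y : T) : R := if 0 < y then c / (c + y) ^+ 2 else 0.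

Lemma ratio_density_ge0 y : 0 <= ratio_density y.
Proof. by rewrite /ratio_density; case: ifP => // _; rewrite divr_ge0 ?sqr_ge0 ?ltW. Qed.

Let density_patch : EFin \o ratio_density =
  (fun y : T => (c / (c + y) ^+ 2)%:E) \_ `]0, +oo[.
Proof.
apply/funext => y /=; rewrite /ratio_density patchE mem_setE in_itv/= andbT.
by case: ifP.
Qed.

Let integral_density (A : set T) :
  (\int[mu]_(y in A) (ratio_density y)%:E =
   \int[mu]_(y in A `&` `]0%R, +oo[) (c / (c + y) ^+ 2)%:E)%E.
Proof.
by rewrite integral_mkcondr; apply: eq_integral => y _; rewrite -density_patch.
Qed.

Lemma measurable_ratio_density : measurable_fun setT ratio_density.
Proof.
apply: measurable_fun_ifT => //; first exact: measurable_fun_ltr.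
apply: measurable_funM => //.
apply: measurableT_comp; first exact: measurable_inv.
by apply: measurable_funX; exact: measurable_funD.
Qed.

Lemma integrable_ratio_density : mu.-integrable setT (EFin \o ratio_density).
Proof.
apply/integrableP; split.
  by apply/measurable_EFinP; exact: measurable_ratio_density.
under eq_integral do rewrite gee0_abs ?lee_fin ?ratio_density_ge0//.
by rewrite integral_density setTI integral_ratio_density// ltry.
Qed.

Let phi (y : T) : T := c / (c + y).

Let mphi : measurable_fun setT phi.
Proof.
apply: measurable_funM => //.
by apply: measurableT_comp; [exact: measurable_inv|exact: measurable_funD].
Qed.

Let m := density_measure ratio_density_ge0 integrable_ratio_density.

(** The map [phi] decreases from [1] to [0] on the positive half-line. For [0 < x <= 1] the preimage
    there is [(c / x - c, +oo)], whose mass is [c / (c / x) = x]; the other two cases give [0] and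
    [1]. *)
Let m_itv (x : R) : pushforward m phi `]-oo, x[ = mu (`]-oo, x[ `&` `]0, 1[).
Proof.
rewrite /pushforward /m /density_measure integral_density.
have [x0|x0] := leP x 0.
  have -> : `]-oo, x[ `&` `]0, 1[ = set0 :> set T.
    apply/seteqP; split => y //=; rewrite !in_itv/= => -[yx /andP[y0 _]].
    by have := lt_le_trans (lt_trans y0 yx) x0; rewrite ltxx.
  have -> : phi @^-1` `]-oo, x[ `&` `]0, +oo[ = set0 :> set T.
    apply/seteqP; split => y //=; rewrite !in_itv/= andbT => -[yx y0].
    have : 0 < phi y by rewrite divr_gt0// addr_gt0.
    by move=> /lt_trans/(_ yx) /lt_le_trans/(_ x0); rewrite ltxx.
  by rewrite integral_set0 measure0.
have [x1|x1] := leP x 1.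
  have -> : phi @^-1` `]-oo, x[ `&` `]0, +oo[ = `]c / x - c, +oo[%classic :> set T.
    apply/seteqP; split => y /=; rewrite !in_itv/= !andbT.
      move=> [+ y0]; rewrite /phi ltr_pdivrMr ?addr_gt0// ltrBlDr ltr_pdivrMr//.
      by rewrite mulrC addrC.
    rewrite ltrBlDr ltr_pdivrMr// => xy; have y0 : 0 < y.
      have : c <= c / x by rewrite ler_pdivlMr// ler_piMr// ltW.
      by move: xy; rewrite -ltr_pdivrMr//; lra.
    by split => //; rewrite /phi ltr_pdivrMr ?addr_gt0// mulrC addrC.
  rewrite integral_ratio_density; last first.
    by rewrite subr_ge0 ler_pdivlMr// ler_piMr// ltW.
  have -> : `]-oo, x[ `&` `]0, 1[ = `]0, x[%classic :> set T.
    apply/seteqP; split => y /=; rewrite !in_itv/=.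
      by move=> [-> /andP[-> _]].
    by move=> /andP[-> yx]; rewrite yx (lt_le_trans yx).
  rewrite lebesgue_measure_itv/= lte_fin x0 -EFinB subr0; congr EFin.
  by rewrite addrC subrK invfM invrK mulrA divff ?mul1r// gt_eqF.
have -> : phi @^-1` `]-oo, x[ `&` `]0, +oo[ = `]0, +oo[%classic :> set T.
  apply/seteqP; split => y /=; rewrite !in_itv/= !andbT; first by case.
  move=> y0; split => //; apply: lt_trans x1.
  by rewrite /phi ltr_pdivrMr ?addr_gt0// mul1r ltrDl.
rewrite integral_ratio_density//.
have -> : `]-oo, x[ `&` `]0, 1[ = `]0, 1[%classic :> set T.
  apply/seteqP; split => y /=; rewrite !in_itv/=; first by case.
  by move=> /andP[-> y1]; rewrite y1 (lt_trans y1).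
by rewrite lebesgue_measure_itv/= lte_fin ltr01 -EFinB subr0 addr0 divff// gt_eqF.
Qed.

(** Open half-lines to the left are stable under intersection, generate the Borel sets and exhaust
    the line, so agreement on them determines the measure. *)
Let mE (A : set T) : measurable A -> pushforward m phi A = mu (A `&` `]0, 1[).
Proof.
move=> mA.
have m01 : measurable (`]0, 1[%classic : set T) by [].
apply: (@measure_unique _ R T (@RGenInftyO.G R) (fun k => `]-oo, k%:R[%classic) _ _ _ _
  (pushforward m phi) (mrestr mu m01)) => //.
- exact: RGenInftyO.measurableE.
- move=> _ _ [x ->] [y ->]; exists (Order.min x y).
  by apply/seteqP; split => z /=; rewrite !in_itv/= lt_min => /andP.
- by move=> k; exists k%:R.
- apply/seteqP; split => // x _; exists (Num.truncn x).+1 => //=.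
  by rewrite in_itv/= truncnS_gt.
- by move=> _ [x ->]; exact: m_itv.
- move=> k; rewrite [X in (X < _)%E](m_itv k%:R).
  have : (mu (`]-oo, k%:R%R[ `&` `]0%R, 1%R[) <= mu `]0%R, 1%R[)%E by apply: measureIr.
  move/le_lt_trans; apply.
  by rewrite lebesgue_measure_itv/= lte_fin ltr01 -EFinB ltry.
Qed.

(** Lebesgue measure on [(0, 1)] is the image under [phi] of the measure with density
    [ratio_density]. Arguing through image measures demands only measurability of [f]. *)
Lemma ge0_integral_ratio (f : R -> \bar R) :
  (forall z, 0 <= f z)%E -> measurable_fun (setT : set T) f ->
  (\int[mu]_(z in `]0%R, 1%R[) f z =
   \int[mu]_(y in `]0%R, +oo[) (f (c / (c + y))%R * (c / (c + y) ^+ 2)%:E))%E.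
Proof.
move=> f0 mf.
have -> : (\int[mu]_(z in `]0%R, 1%R[) f z =
    \int[pushforward m phi]_(z in `]0%R, 1%R[) f z)%E.
  by apply: eq_measure_integral => A mA A01; have := mE mA; rewrite setIidl// => /esym.
rewrite ge0_integral_pushforward//; last exact: measurable_funTS.
rewrite integral_mkcond.
rewrite (@ge0_integral_density _ T R m mu _ ratio_density_ge0
  measurable_ratio_density (fun A _ => erefl))//; last 2 first.
- by move=> y; rewrite patchE; case: ifP => // _; exact: f0.
- have mp01 : measurable (phi @^-1` `]0, 1[).
    by rewrite -[_ @^-1` _]setTI; exact: mphi.
  apply/(measurable_restrictT _ mp01).
  by apply: measurable_funTS; apply: measurableT_comp mf mphi.
rewrite [RHS]integral_mkcond; apply: eq_integral => y _.
rewrite [RHS]patchE mem_setE in_itv/= andbT /ratio_density.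
case: (ltP 0 y) => y0; last by rewrite mule0.
rewrite patchE mem_set// /preimage/= in_itv/=.
by rewrite divr_gt0 ?addr_gt0//= ltr_pdivrMr ?addr_gt0// mul1r ltrDl y0.
Qed.
End ratio_change_of_variables.

Section ratio_transfer.
Context {R : realType}.
Local Notation mu := (@lebesgue_measure R).
Local Notation T := (measurableTypeR R).

(** The substitution applied to the indicator of the exceptional set gives a zero integral. The
    Jacobian is positive, so the preimage of that set is null as well. *)
Lemma ae_ratio (c : R) (Q : R -> Prop) : 0 < c ->
  {ae mu, forall z, 0 < z < 1 -> Q z} ->
  {ae mu, forall y, 0 < y -> Q (c / (c + y))}.
Proof.
move=> c0 [N [mN N0 QN]].
have mphi : measurable_fun (setT : set T) (fun y : T => c / (c + y) : T).
  apply: measurable_funM => //.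
  by apply: measurableT_comp; [exact: measurable_inv|exact: measurable_funD].
have m1 : measurable_fun (setT : set T) (fun z : T => ((\1_N z : R)%:E)).
  by apply/measurable_EFinP; exact: measurable_indic.
have mw : measurable_fun (`]0, +oo[%classic : set T)
    (fun y : T => (\1_N (c / (c + y)) : R)%:E * (c / (c + y) ^+ 2)%:E)%E.
  apply: emeasurable_funM.
    by apply: measurable_funTS; apply: measurableT_comp m1 mphi.
  apply/measurable_EFinP; apply: measurable_funTS; apply: measurable_funM => //.
  apply: measurableT_comp; first exact: measurable_inv.
  by apply: measurable_funX; exact: measurable_funD.
have H : (\int[mu]_(y in `]0%R, +oo[)
    ((\1_N (c / (c + y)) : R)%:E * (c / (c + y) ^+ 2)%:E) = 0)%E.
  rewrite -(@ge0_integral_ratio R c c0 (fun z => (\1_N z)%:E))//.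
  rewrite integral_indic//; apply: (subset_measure0 _ mN) N0 => //.
  exact: measurableI.
have /(ae_eq_integral_abs mu (measurable_itv _) mw) : (\int[mu]_(y in `]0%R, +oo[)
    `|(\1_N (c / (c + y)) : R)%:E * (c / (c + y) ^+ 2)%:E| = 0)%E.
  rewrite -[RHS]H.
  apply: eq_integral => y _; rewrite gee0_abs//.
  by rewrite mule_ge0 ?lee_fin ?divr_ge0 ?sqr_ge0// ltW.
move=> Hae; apply: (@filterS _ _ (ae_filter_ringOfSetsType mu) _ _ _ Hae).
move=> y /[swap] y0; rewrite /= in_itv/= andbT => /(_ y0)/eqP.
rewrite -EFinM eqe mulf_eq0 orbC mulf_eq0 gt_eqF//= invr_eq0 expf_eq0/=.
rewrite gt_eqF ?addr_gt0//= indicE => yN; apply: contrapT => nQ.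
move: yN; rewrite mem_set ?oner_eq0//; apply: QN => /= /(_ _)/nQ; apply.
by rewrite divr_gt0 ?addr_gt0//= ltr_pdivrMr ?addr_gt0// mul1r ltrDl.
Qed.
End ratio_transfer.

(** * Joint law of two independent variables with densities *)

Section joint_density.
Context d (Om : measurableType d) (R : realType) (P : probability Om R).
Local Notation mu := (@lebesgue_measure R).
Local Notation T := (measurableTypeR R).

(** The event that [X] falls in [A] outside [(0, +oo)] is null, so the density may be cut off to the
    positive half-line. *)
Lemma positive_density (X : {RV P >-> R}) (fX : R -> R) :
  {ae P, forall w, 0 < X w} -> is_density P X fX ->
  forall A : set R, measurable A ->
    P (X @^-1` A) = (\int[mu]_(x in A) ((fX \_ `]0, +oo[) x)%:E)%E.
Proof.
move=> [N [mN N0 XN]] [_ [_ dX]] A mA.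
have mD : measurable (`]0, +oo[%classic : set R) by [].
have mX (B : set R) : measurable B -> measurable (X @^-1` B).
  by move=> mB; rewrite -[X in measurable X]setTI; exact: measurable_funP.
rewrite (_ : X @^-1` A =
    X @^-1` (A `&` `]0, +oo[) `|` X @^-1` (A `\` `]0, +oo[)); last first.
  by rewrite -preimage_setU setUIDK.
rewrite measureU0; last 3 first.
- by apply: mX; exact: measurableI.
- by apply: mX; exact: measurableD.
- apply: (subset_measure0 _ mN) N0; first by apply: mX; exact: measurableD.
  by move=> w /= [_]; rewrite in_itv/= andbT => Xw; exact: XN.
apply: (etrans (dX _ _)); first exact: measurableI.
by rewrite integral_mkcondr; apply: eq_integral => x _; rewrite !patchE; case: ifP.
Qed.

Variables (X Y : {RV P >-> T}) (fX fY : T -> R).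
Hypotheses (fX0 : forall x, 0 <= fX x) (mfX : measurable_fun setT fX).
Hypotheses (fY0 : forall x, 0 <= fY x) (mfY : measurable_fun setT fY).
Hypothesis dX : forall A, measurable A ->
  distribution P X A = (\int[mu]_(x in A) (fX x)%:E)%E.
Hypothesis dY : forall A, measurable A ->
  distribution P Y A = (\int[mu]_(x in A) (fY x)%:E)%E.
Hypothesis XY : forall A B, measurable A -> measurable B ->
  P (X @^-1` A `&` Y @^-1` B) = (P (X @^-1` A) * P (Y @^-1` B))%E.

(** Independence says that the joint law agrees with the product of the marginals on rectangles,
    hence everywhere; Tonelli then reduces the integral to the two densities. *)
Lemma ge0_integral_joint_density (f : T * T -> \bar R) :
  (forall z, 0 <= f z)%E -> measurable_fun setT f ->
  (\int[P]_w f (X w, Y w) =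
   \int[mu]_x (\int[mu]_y (f (x, y) * (fY y)%:E) * (fX x)%:E))%E.
Proof.
move=> f0 mf.
have mXY : measurable_fun setT (fun w => (X w, Y w)).
  by apply/measurable_fun_pairP; split; exact: measurable_funP.
have -> : (\int[P]_w f (X w, Y w) = \int[pushforward P (fun w => (X w, Y w))]_z f z)%E.
  by rewrite ge0_integral_pushforward.
rewrite (eq_measure_integral (distribution P X \x distribution P Y)%E); last first.
  move=> A mA _; apply/esym.
  apply: (product_measure_unique (m1 := distribution P X) (m2 := distribution P Y)) => //.
rewrite fubini_tonelli1//.
rewrite (ge0_integral_density fX0 mfX dX); last 2 first.
- by move=> x; apply: integral_ge0.
- exact: measurable_fun_fubini_tonelli_F.
apply: eq_integral => x _; congr (_ * _)%E.
rewrite /fubini_F (ge0_integral_density fY0 mfY dY)//.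
exact: measurableT_comp.
Qed.

End joint_density.

Section ratio_of_independent.
Context d (Om : measurableType d) (R : realType) (P : probability Om R).
Context d' (Om' : measurableType d') (P' : probability Om' R).
Local Notation mu := (@lebesgue_measure R).
Local Notation T := (measurableTypeR R).
Variables (X Y : {RV P >-> R}) (Z : {RV P' >-> R}) (fX fY fZ : R -> R).

(** Given [X = x], the substitution [y = x * (z^-1 - 1)] has Jacobian [x / z ^+ 2], which yields the
    conditional density of the ratio. Averaging over [X], both sides have the same integral over
    every measurable subset of [(0, 1)]. *)
Lemma density_of_ratio :
  {ae P, forall w, 0 < X w} -> {ae P, forall w, 0 < Y w} ->
  is_density P X fX -> is_density P Y fY -> is_density P' Z fZ ->
  indep2 P X Y ->
  (forall S : set R, measurable S ->
    P' (Z @^-1` S) = P ((fun w => X w / (X w + Y w)) @^-1` S)) ->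
  ae_eq mu (`]0, 1[%classic : set T) (EFin \o fZ) (fun z => \int[mu]_(x in `]0%R, +oo[)
    (fX x * (fY (x * (z^-1 - 1)) * (x / z ^+ 2)))%:E)%E.
Proof.
move=> X0 Y0 hX hY hZ XY ZXY.
have [fX0 [mfX _]] := hX; have [fY0 [mfY _]] := hY; have [fZ0 [mfZ dZ]] := hZ.
pose D : set T := `]0, +oo[%classic.
have mD : measurable D by exact: measurable_itv.
have DE x : (x \in D) = (0 < x) by rewrite mem_setE in_itv/= andbT.
have mX : measurable_fun (setT : set Om) (X : Om -> T).
  by have mX := measurable_funPT X; exact: mX.
have mY : measurable_fun (setT : set Om) (Y : Om -> T).
  by have mY := measurable_funPT Y; exact: mY.
pose X' : {RV P >-> T} := HB.pack (X : Om -> T) (isMeasurableFun.Build _ _ _ _ _ mX).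
pose Y' : {RV P >-> T} := HB.pack (Y : Om -> T) (isMeasurableFun.Build _ _ _ _ _ mY).
have pX := positive_density X0 hX; have pY := positive_density Y0 hY.
have fX'0 x : 0 <= (fX \_ D) x by rewrite patchE; case: ifP.
have fY'0 x : 0 <= (fY \_ D) x by rewrite patchE; case: ifP.
have mfX' : measurable_fun (setT : set T) (fX \_ D).
  by apply/(measurable_restrictT _ mD); exact: measurable_funTS.
have mfY' : measurable_fun (setT : set T) (fY \_ D).
  by apply/(measurable_restrictT _ mD); exact: measurable_funTS.
have J := @ge0_integral_joint_density _ _ _ P X' Y' _ _ fX'0 mfX' fY'0 mfY' pX pY XY.
have mratio : measurable_fun setT (fun z : T * T => z.1 / (z.1 + z.2) : T).
  apply: measurable_funM; first exact: measurable_fst.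
  apply: measurableT_comp; first exact: measurable_inv.
  by apply: measurable_funD; [exact: measurable_fst|exact: measurable_snd].
(* The joint density of [X] and the ratio on [z] in [(0, 1)]; it vanishes for [x <= 0]. *)
pose k (x z : T) : R := (fX \_ D) x * (fY (x * (z^-1 - 1)) * (x / z ^+ 2)).
have mk : measurable_fun setT (fun z : T * T => k z.1 z.2).
  apply: measurable_funM; first exact: measurableT_comp mfX' measurable_fst.
  apply: measurable_funM.
    apply: (measurableT_comp mfY); apply: measurable_funM; first exact: measurable_fst.
    apply: measurable_funB => //.
    by apply: measurableT_comp measurable_snd; exact: measurable_inv.
  apply: measurable_funM; first exact: measurable_fst.
  apply: measurableT_comp; first exact: measurable_inv.
  by apply: measurable_funX; exact: measurable_snd.
have k0 x z : 0 <= k x z.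
  rewrite /k patchE DE; case: ltP => x0; last by rewrite mul0r.
  by rewrite mulr_ge0// mulr_ge0// divr_ge0 ?sqr_ge0 ?ltW.
have kE z : (\int[mu]_(x in `]0%R, +oo[) (fX x * (fY (x * (z^-1 - 1)) * (x / z ^+ 2)))%:E
    = \int[mu]_x (k x z)%:E)%E.
  rewrite integral_mkcond; apply: eq_integral => x _.
  by rewrite patchE DE /k patchE DE; case: ltP => // x0; rewrite mul0r.
rewrite (_ : (fun z => _) = fun z => \int[mu]_x (k x z)%:E)%E; last first.
  by apply/funext => z; exact: kE.
have iZ : mu.-integrable setT (EFin \o fZ).
  apply/integrableP; split; first by apply/measurable_EFinP; exact: mfZ.
  under eq_integral do rewrite gee0_abs ?lee_fin//=.
  by rewrite -dZ// preimage_setT probability_setT ltry.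
apply: integral_ae_eq => //.
- exact: integrableS iZ.
- apply: measurable_funTS.
  apply: (@measurable_fun_fubini_tonelli_G _ _ _ _ _ mu (fun z : T * T => (k z.1 z.2)%:E)).
    exact/measurable_EFinP.
  by move=> z; rewrite lee_fin.
move=> S S01 mS.
have m1S : measurable_fun (setT : set T) (\1_S : T -> R) by exact: measurable_indic.
rewrite -dZ// ZXY//.
transitivity (\int[P]_w (\1_S (X w / (X w + Y w)) : R)%:E)%E.
  pose E := (fun w => X w / (X w + Y w)) @^-1` S.
  have mE : measurable E.
    have mXY : measurable_fun setT (fun w => X w / (X w + Y w) : T).
      exact: measurableT_comp mratio (measurable_fun_pair mX mY).
    by rewrite -[E]setTI; exact: mXY.
  rewrite (_ : (fun w => _) = EFin \o \1_E); last first.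
    by apply/funext => w; rewrite /= !indicE.
  by rewrite integral_indic// setIT.
rewrite (J (fun z => (\1_S (z.1 / (z.1 + z.2)))%:E)); last 2 first.
- by move=> z; rewrite lee_fin.
- by apply/measurable_EFinP; exact: measurableT_comp m1S mratio.
transitivity (\int[mu]_x \int[mu]_z (\1_S z * k x z)%:E)%E.
  apply: eq_integral => x _ /=.
  rewrite [(fX \_ D) x]patchE DE; case: ltP => x0; last first.
    rewrite mule0; apply/esym/integral0_eq => z _.
    by rewrite /k patchE DE ltNge x0/= mul0r mulr0.
  pose F z : \bar R := (\1_S z * (fY (x * (z^-1 - 1)) * (x / z ^+ 2)))%:E.
  have F0 z : (0 <= F z)%E.
    by rewrite lee_fin mulr_ge0// mulr_ge0// divr_ge0 ?sqr_ge0 ?ltW.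
  have mF : measurable_fun (setT : set T) F.
    apply/measurable_EFinP; apply: measurable_funM => //.
    have mV : measurable_fun setT (fun z : T => z^-1 : R) by exact: measurable_inv.
    apply: measurable_funM.
      apply: (measurableT_comp mfY); apply: measurable_funM => //.
      exact: measurable_funB.
    apply: measurable_funM => //; apply: (measurableT_comp measurable_inv).
    exact: measurable_funX.
  have -> : (\int[mu]_y ((\1_S (x / (x + y)))%:E * ((fY \_ D) y)%:E) = \int[mu]_z F z)%E.
    (* [S] lies in [(0, 1)], so [F] vanishes outside it and the substitution with [c = x] is
       available. *)
    transitivity (\int[mu]_(z in `]0%R, 1%R[) F z)%E; last first.
      rewrite integral_mkcond; apply: eq_integral => z _.
      rewrite patchE; case: ifPn => //; rewrite notin_setE => z01.
      by rewrite /F indicE memNset ?mul0r// => /S01.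
    rewrite (ge0_integral_ratio x0 F0 mF) [RHS]integral_mkcond.
    apply: eq_integral => y _; rewrite !patchE DE; case: ltP => y0; last by rewrite mule0.
    rewrite /F -!EFinM; congr EFin; rewrite -!mulrA; congr (_ * _).
    have xy0 : x + y != 0 by rewrite gt_eqF// addr_gt0.
    have x_neq0 : x != 0 by rewrite gt_eqF.
    have -> : x * ((x / (x + y))^-1 - 1) = y by field; rewrite ?xy0 ?x_neq0.
    (* At [z = x / (x + y)] the factors [x / z ^+ 2] and [x / (x + y) ^+ 2] are inverse to each
       other. *)
    by rewrite -[LHS]mulr1; congr (_ * _); field; rewrite ?xy0 ?x_neq0.
  rewrite -ge0_integralZr ?lee_fin//.
  by apply: eq_integral => z _; rewrite /F /k patchE DE x0 -EFinM; congr EFin; ring.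
transitivity (\int[mu]_z \int[mu]_x (\1_S z * k x z)%:E)%E.
  apply: (@fubini_tonelli _ _ _ _ _ mu mu (fun z : T * T => (\1_S z.2 * k z.1 z.2)%:E)).
    apply/measurable_EFinP; apply: measurable_funM => //.
    exact: measurableT_comp m1S measurable_snd.
  by move=> z; rewrite lee_fin mulr_ge0.
rewrite [RHS]integral_mkcond; apply: eq_integral => z _.
rewrite patchE; case: ifPn => zS.
  by apply: eq_integral => x _; rewrite indicE zS mul1r.
by rewrite integral0_eq// => x _; rewrite indicE (negbTE zS) mul0r.
Qed.

End ratio_of_independent.

(** * Recovering the density of [X] from the factorization of [fY] *)

Theorem theorem2 (R : realType)
  (d : measure_display) (T : measurableType d) (P : probability T R)
  (d' : measure_display) (T' : measurableType d') (P' : probability T' R)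
  (X Y : {RV P >-> R}) (Z : {RV P' >-> R})
  (fX fY fZ : R -> R) (A B C : R -> R) (p q lam : R)
  (hXpos : {ae P, forall w, 0 < X w})
  (hYpos : {ae P, forall w, 0 < Y w})
  (hZpos : {ae P', forall w, 0 < Z w})
  (hfX : is_density P X fX) (hfY : is_density P Y fY) (hfZ : is_density P' Z fZ)
  (hind : indep2 P X Y)
  (hZ : forall S : set R, measurable S ->
          P' (Z @^-1` S) = P ((fun w => X w / (X w + Y w)) @^-1` S))
  (hA : forall s, 0 < s -> 0 < A s)
  (hB : forall x, 0 < x -> 0 < B x)
  (hC : forall x, 0 < x -> 0 < C x)
  (hdec : forall x s, 0 < x -> 0 < s -> fY (s * x) = A s * B x * C (s * x))
  (hq : 0 < q) (hlam : 0 < lam) (hp : 0 <= p)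
  (hCdef : forall x, 0 < x -> C x = (p + q * x) * expR (- (lam * x)))
  (hlim : (fun x => x `^ (lam * p / q + 2) * B x * fX x) x @[x --> 0^'+] --> 0)
  (h : R -> R)
  (hh : is_inv_laplace
          (fun s => (A (s / lam) * (s + lam) ^+ 2)^-1 * fZ (lam / (s + lam))) h) :
  {ae lebesgue_measure, forall x : R, 0 < x ->
     fX x = lam ^+ 3 / (q * x `^ (lam * p / q + 2) * B x) *
            Rintegral lebesgue_measure `]0, x[%classic
              (fun xi => xi `^ (lam * p / q) * h xi)}.
Proof.
set mu := lebesgue_measure; set a := lam * p / q.
pose TR := measurableTypeR R; pose D : set TR := `]0, +oo[%classic.
have mD : measurable D by exact: measurable_itv.
have DE (x : TR) : (x \in D) = (0 < x) by rewrite mem_setE in_itv/= andbT.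
have a0 : 0 <= a by rewrite divr_ge0 ?mulr_ge0// ltW.
have [fX0 [mfX _]] := hfX; have [_ [mfY _]] := hfY.
(* The constant is fixed by [(a / x + s) * (q / lam ^+ 3) * x ^+ 2 = x / lam ^+ 2 * (p + q * (s /
   lam * x))], where the last factor is the polynomial part of [C (s / lam * x)]. *)
pose G x := q / lam ^+ 3 * (x ^+ 2 * B x * fX x).
have G0 x : 0 < x -> 0 <= G x.
  move=> x0; have /ltW Bx := hB _ x0.
  rewrite mulr_ge0 ?divr_ge0 ?exprn_ge0 ?(ltW hq) ?(ltW hlam)//.
  by rewrite mulr_ge0// mulr_ge0 ?sqr_ge0.
have mG : measurable_fun D G.
  (* Measurability of [B] on the positive half-line is extracted from that of [fY]: the
     factorization at scale [1] reads [B x = fY x / (A 1 * C x)]. *)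
  have e x : D x -> G x =
      q / lam ^+ 3 * (x ^+ 2 * (fY x *
        (A 1 * ((p + q * x) * expR (- (lam * x))))^-1) * fX x).
    rewrite /D/= in_itv/= andbT => x0; rewrite /G.
    have := hdec _ _ x0 ltr01; rewrite !mul1r => ->; rewrite -hCdef//.
    have := hA _ ltr01; have := hC _ x0 => /lt0r_neq0 Cx /lt0r_neq0 A1.
    by congr (_ * (_ * _ * _)); field; rewrite Cx A1.
  pose F : TR -> R := fun x => q / lam ^+ 3 * (x ^+ 2 * (fY x *
      (A 1 * ((p + q * x) * expR (- (lam * x))))^-1) * fX x).
  have mF : measurable_fun (setT : set TR) F; last first.
    have FG : {in D, F =1 G} by move=> t tD; rewrite (e t (set_mem tD)).
    have mFD : measurable_fun D F by exact: measurable_funTS.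
    exact: (eq_measurable_fun F FG mFD).
  have mM (f g : TR -> R) : measurable_fun (setT : set TR) f -> measurable_fun setT g ->
    measurable_fun setT (fun x => f x * g x) := @measurable_funM _ _ _ _ f g.
  have mc (c : R) : measurable_fun (setT : set TR) (fun=> c) by exact: measurable_cst.
  have mid : measurable_fun (setT : set TR) (id : TR -> R) by exact: measurable_id.
  apply: (mM); first exact: mc.
  apply: (mM _ _ _ mfX); apply: (mM); first exact: measurable_funX.
  apply: (mM _ _ mfY); apply: measurableT_comp; first exact: measurable_inv.
  apply: (mM); first exact: mc.
  apply: (mM); first by apply: measurable_funD; [exact: mc|exact: mM].
  apply: measurableT_comp; first exact: measurable_expR.
  by apply: measurableT_comp; [exact: oppr_measurable|exact: mM].
apply: (@filterS _ _ (ae_filter_ringOfSetsType mu) _ _ _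
  (@laplace_ode R a G h a0 G0 mG (fun s s0 => (hh _ s0).1) _)).
  move=> x + x0 => /(_ x0) <-.
  rewrite powRD; last by rewrite (gt_eqF x0) implybT.
  rewrite (powR_mulrn 2 (ltW x0)).
  have /lt0r_neq0 := powR_gt0 a x0; have /lt0r_neq0 := hB _ x0.
  rewrite /G => Bx xa; field.
  by rewrite xa Bx (lt0r_neq0 hq) (lt0r_neq0 x0) (lt0r_neq0 hlam).
have ratio := density_of_ratio hXpos hYpos hfX hfY hfZ hind hZ.
have {}ratio : {ae mu, forall z, 0 < z < 1 -> ((fZ z)%:E = \int[mu]_(x in `]0%R, +oo[)
    (fX x * (fY (x * (z^-1 - 1)) * (x / z ^+ 2)))%:E)%E}.
  apply: (@filterS _ _ (ae_filter_ringOfSetsType mu) _ _ _ ratio) => z /= Hz z01.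
  by apply: Hz; rewrite in_itv.
(* The formula for [fZ] holds for almost every [z] in [(0, 1)], hence at [z = lam / (lam + s)] for
   almost every [s > 0]. *)
have := ae_ratio hlam ratio.
apply: (@filterS _ _ (ae_filter_ringOfSetsType mu)) => s /[swap] s0 /(_ s0).
have As := hA _ (divr_gt0 s0 hlam).
pose c := A (s / lam) * (s + lam) ^+ 2.
have c0 : 0 < c by rewrite mulr_gt0// exprn_gt0// addr_gt0.
(* Here [z^-1 - 1 = s / lam], so the factorization applies at scale [s / lam]. The exponential in
   [C] becomes [expR (- (s * x))], and the factors free of [x] collect into [c]. *)
have -> : (\int[mu]_(x in `]0%R, +oo[)
    (fX x * (fY (x * ((lam / (lam + s))^-1 - 1)) * (x / (lam / (lam + s)) ^+ 2)))%:E =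
    c%:E * \int[mu]_(x in `]0%R, +oo[) (expR (- (s * x)) * ((a / x + s) * G x))%:E)%E.
  rewrite -ge0_integralZl//; last 3 first.
  - have e : (fun x => expR (- (s * x)) * ((a / x + s) * G x)) =
        (fun x => expR (- (s * x)) * (a * x^-1 + s) * G x).
      by apply/funext => x; rewrite mulrA.
    apply/measurable_EFinP; rewrite e; apply: measurable_funM mG.
    apply: measurable_funTS; apply: measurable_funM.
      apply: measurableT_comp; first exact: measurable_expR.
      by apply: measurableT_comp; [exact: oppr_measurable|exact: measurable_funM].
    by apply: measurable_funD => //; apply: measurable_funM => //; exact: measurable_inv.
  - move=> x /=; rewrite in_itv/= andbT => x0.
    rewrite lee_fin mulr_ge0 ?expR_ge0// mulr_ge0 ?G0// addr_ge0 ?(ltW s0)//.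
    by rewrite divr_ge0// ltW.
  - by rewrite lee_fin ltW.
  apply: eq_integral => x; rewrite DE => x0; rewrite -EFinM; congr EFin.
  have ls0 : lam + s != 0 by rewrite gt_eqF// addr_gt0.
  have l0 := lt0r_neq0 hlam; have q0 := lt0r_neq0 hq; have xn0 := lt0r_neq0 x0.
  have -> : x * ((lam / (lam + s))^-1 - 1) = s / lam * x by field; rewrite ?l0 ?ls0.
  have slx : 0 < s / lam * x by rewrite mulr_gt0 ?divr_gt0.
  rewrite hdec ?divr_gt0// hCdef//.
  have -> : lam * (s / lam * x) = s * x by field.
  by rewrite /c /G /a; field; rewrite ?l0 ?ls0 ?q0 ?xn0.
(* The transform of [h] at [s] is [c^-1 * fZ (lam / (s + lam))], so the factor [c] cancels. *)
have [ih hs] := hh _ s0.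
have fh := integrable_fin_num mD ih.
rewrite (addrC lam) => Hs.
rewrite -(fineK fh) -[fine _]/(laplace h s) hs -/c EFinM Hs muleA -EFinM mulVf ?mul1e//.
exact: lt0r_neq0.
Qed.
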